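(* Let $n\ge0$ be an integer, $\beta$ a complex number, and $G_n^\beta=U_nE^{n\beta}U_n^{-1}$ acting on the space $\mathcal P_n$ of complex polynomials of degree at most $n$. Then $$G_n^\beta=V_n^{-1}\,B_{n\beta}\,V_n ,$$ where $B_{n\beta}$ is the operator $x^p\mapsto\sum_{i=0}^{p}\binom{n\beta}{p-i}x^i$ on $\mathcal P_n$ (the transpose of the Riordan array $((1+x)^{n\beta},x)$, truncated to $\mathcal P_n$).
   Context: The Euler polynomials $A_k(x)$ are defined by $\frac{A_k(x)}{(1-x)^{k+1}}=\sum_{m\ge0}m^kx^m$, with $A_0=1$. Operators on $\mathcal P_n$, given on $x^p$, $p=0,\dots,n$: $U_n x^p=\frac1{n!}(1-x)^{n-p}A_p(x)$ (invertible, with $U_n^{-1}x^p=(x)_p[x+1]_{n-p}$, falling and rising factorials); $E^{c}f(x)=f(x+c)$; $V_nx^p=(1+x)^{n-p}x^p$ (so $V_n^{-1}x^p=(1-x)^{n-p}x^p$). $\binom{c}{k}=c(c-1)\cdots(c-k+1)/k!$ for complex $c$. *)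

(* Defs.v *)
From HB Require Import structures.
From mathcomp Require Import all_boot all_order all_algebra.
From mathcomp Require Import ring complex reals.

Set Implicit Arguments.
Unset Strict Implicit.
Unset Printing Implicit Defensive.

Import Order.TTheory GRing.Theory Num.Theory.
Local Open Scope ring_scope.

Section Operators.
Variable K : numFieldType.

(* Of the defining identity A_k = (1-x)^(k+1) * sum_(m >= 0) m^k x^m between
   formal power series, only the terms of degree at most k are used here;
   [eulerP] shows that the identity holds modulo x^N for every N. The
   convention 0^0 = 1 gives A_0 = 1. *)
Definition euler (k : nat) : {poly K} :=
  take_poly k.+1 ((1 - 'X) ^+ k.+1 * \poly_(m < k.+1) m%:R ^+ k).

Lemma size_euler k : (size (euler k) <= k.+1)%N.
Proof. exact: size_take_poly. Qed.

Lemma eulerian_exists k : exists2 a : {poly K}, (size a <= k.+1)%N &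
  forall N, 'X^N %| (1 - 'X) ^+ k.+1 * \poly_(m < N) m%:R ^+ k - a.
Proof.
elim: k => [|k [a sa Ha]].
  exists 1 => [|N]; first by rewrite size_poly1.
  rewrite expr1 (_ : \poly_(m < N) _ = \sum_(i < N) 'X^i); last first.
    by rewrite poly_def; apply: eq_bigr => i _; rewrite expr0 scale1r.
  by rewrite -[1 - 'X]opprB mulNr -subrX1 opprB addrAC subrr add0r dvdpNr.
exists ((1 - 'X) * ('X * a^`()) + k.+1%:R * ('X * a)) => [|N].
  have sX (p : {poly K}) j : (size p <= j)%N -> (size ('X * p)%R <= j.+1)%N.
    move=> sp; rewrite (leq_trans (size_polyMleq _ _)) // size_polyX.
    by rewrite add2n.
  rewrite (leq_trans (size_polyD _ _)) // geq_max; apply/andP; split.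
    rewrite (leq_trans (size_polyMleq _ _)) // -opprB size_polyN size_XsubC.
    rewrite add2n /= ltnS sX //.
    have [->|a0] := eqVneq a 0; first by rewrite deriv0 size_poly0.
    by rewrite -ltnS (leq_trans (lt_size_deriv a0)).
  rewrite mulr_natl -scaler_nat (leq_trans (size_scale_leq _ _)) //.
  exact: sX.
have XD (p : {poly K}) : 'X^N %| p -> 'X^N %| 'X * p^`().
  case/dvdpP => q ->; rewrite derivM mulrDr dvdp_add //.
    by rewrite mulrA dvdp_mull.
  rewrite derivXn; case: (N) => [|M]; first by rewrite expr0 dvd1p.
  by rewrite /= mulrCA mulrnAr -exprS -mulr_natr dvdp_mull // dvdp_mulr.
set S := \poly_(m < N) _; pose T : {poly K} := \poly_(m < N) m%:R ^+ k.
have ST : S = 'X * T^`().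
  apply/polyP => i; rewrite mulrC coefMX coef_poly.
  case: i => [|i] /=; first by rewrite expr0n /= if_same.
  rewrite coef_deriv coef_poly; case: ifP => _; last by rewrite mul0rn.
  by rewrite exprSr mulr_natr.
have := Ha N; rewrite -/T => Hp; have Hd := XD _ Hp.
have := dvdp_add (dvdp_mull (1 - 'X) Hd) (dvdp_mull (k.+1%:R * 'X) Hp).
congr (_ %| _).
rewrite derivB derivM deriv_exp derivB derivX derivC sub0r /= ST.
rewrite -[_ *+ k.+1]mulr_natr !exprS.
ring.
Qed.

Lemma eulerP k N : 'X^N %| (1 - 'X) ^+ k.+1 * \poly_(m < N) m%:R ^+ k - euler k.
Proof.
have [a sa Ha] := eulerian_exists k.
suff -> : euler k = a by [].
have /dvdpP[q /(canRL (subrK _)) Eq] := Ha k.+1.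
apply/polyP => i; rewrite /euler Eq coef_take_poly coefD coefMXn.
case: ltnP => [_|ki]; first by rewrite add0r.
by rewrite nth_default // (leq_trans sa).
Qed.

Definition gbinom (c : K) (k : nat) : K :=
  (\prod_(i < k) (c - i%:R)) / k`!%:R.

Section FixedDegree.
Variable n : nat.

(* P_n is {poly_n.+1 K}, because {poly_m K} bounds the size, i.e. 1 + degree. *)

Local Notation mono p := (tnth (npolyX K n.+1) p).

Definition xop_fun (F : nat -> {poly K}) (f : {poly_n.+1 K}) : {poly_n.+1 K} :=
  npolyp n.+1 (\sum_(p < n.+1) f`_p *: F p).

Fact xop_is_linear F : linear (xop_fun F).
Proof.
move=> a f g; apply/val_inj/polyP => i; rewrite /= coefD coefZ !coef_npolyp.
case: ifP => _; last by rewrite mulr0 addr0.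
rewrite !coef_sum mulr_sumr -big_split /=; apply: eq_bigr => p _.
by rewrite coefZ coefD !coefZ mulrDl mulrA.
Qed.
HB.instance Definition _ F := GRing.isLinear.Build K {poly_n.+1 K}
  {poly_n.+1 K} _ (xop_fun F) (xop_is_linear F).

(* The linear operator on P_n sending x^p to F p for p = 0, ..., n; it
   truncates F p to degree at most n, which has no effect in the uses below. *)
Definition xop (F : nat -> {poly K}) : 'End({poly_n.+1 K}) :=
  linfun (xop_fun F).

Lemma xopE (F : nat -> {poly K}) (f : {poly_n.+1 K}) :
    (forall p, (p <= n)%N -> (size (F p) <= n.+1)%N) ->
  xop F f = \sum_(p < n.+1) f`_p *: F p :> {poly K}.
Proof.
move=> sF; rewrite lfunE /= npolypK //.
apply: (leq_trans (size_sum _ _ _)); apply/bigmax_leqP => p _.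
by apply: (leq_trans (size_scale_leq _ _)); apply: sF; rewrite -ltnS.
Qed.

Lemma xopX (F : nat -> {poly K}) (p : 'I_n.+1) :
    (forall p, (p <= n)%N -> (size (F p) <= n.+1)%N) ->
  xop F (mono p) = F p :> {poly K}.
Proof.
move=> sF; rewrite xopE // (bigD1 p) //= big1 ?addr0 => [|q qp].
  by rewrite npolyXE coefXn eqxx scale1r.
by rewrite npolyXE coefXn (inj_eq val_inj) (negPf qp) scale0r.
Qed.

Definition E_fun (c : K) (f : {poly_n.+1 K}) : {poly_n.+1 K} :=
  npolyp n.+1 (f \Po ('X + c%:P)).

Fact E_is_linear c : linear (E_fun c).
Proof.
move=> a f g; apply/val_inj/polyP => i; rewrite /= coefD coefZ !coef_npolyp.
case: ifP => _; last by rewrite mulr0 addr0.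
by rewrite /= comp_polyD comp_polyZ coefD coefZ.
Qed.
HB.instance Definition _ c := GRing.isLinear.Build K {poly_n.+1 K}
  {poly_n.+1 K} _ (E_fun c) (E_is_linear c).

Definition E_op (c : K) : 'End({poly_n.+1 K}) := linfun (E_fun c).

Lemma E_opE c (f : {poly_n.+1 K}) :
  E_op c f = f \Po ('X + c%:P) :> {poly K}.
Proof.
rewrite lfunE /= npolypK // (leq_trans (size_comp_poly_leq _ _)) //.
by rewrite size_XaddC muln1 ltnS -subn1 leq_subLR add1n size_npoly.
Qed.

Definition U_op : 'End({poly_n.+1 K}) :=
  xop (fun p => n`!%:R^-1 *: ((1 - 'X) ^+ (n - p) * euler p)).

Definition V_op : 'End({poly_n.+1 K}) :=
  xop (fun p => (1 + 'X) ^+ (n - p) * 'X^p).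

Definition B_op (c : K) : 'End({poly_n.+1 K}) :=
  xop (fun p => \sum_(i < p.+1) gbinom c (p - i) *: 'X^i).

Let size_1X : size (1 - 'X : {poly K}) = 2.
Proof. by rewrite -opprB size_polyN size_XsubC. Qed.

Let size_XM (q r : {poly K}) p : (size q <= 2)%N -> (p <= n)%N ->
  (size r <= p.+1)%N -> (size (q ^+ (n - p) * r)%R <= n.+1)%N.
Proof.
move=> sq pn sr; rewrite (leq_trans (size_polyMleq _ _)) //.
have : (size (q ^+ (n - p))%R <= (n - p).+1)%N.
  rewrite (leq_trans (size_poly_exp_leq _ _)) // ltnS.
  rewrite -{2}[(n - p)%N]mul1n leq_mul2r; apply/orP; right.
  by rewrite -subn1 leq_subLR.
move=> sX; rewrite -subn1 leq_subLR (leq_trans (leq_add sX sr)) //.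
by rewrite addSn addnS subnK.
Qed.

Lemma U_opX (p : 'I_n.+1) :
  U_op (mono p) = n`!%:R^-1 *: ((1 - 'X) ^+ (n - p) * euler p) :> {poly K}.
Proof.
rewrite xopX // => q qn; rewrite (leq_trans (size_scale_leq _ _)) //.
by rewrite size_XM ?size_euler // size_1X.
Qed.

Lemma V_opX (p : 'I_n.+1) :
  V_op (mono p) = (1 + 'X) ^+ (n - p) * 'X^p :> {poly K}.
Proof.
rewrite xopX // => q qn; rewrite size_XM ?size_polyXn //.
by rewrite addrC size_XaddC.
Qed.

Lemma B_opX c (p : 'I_n.+1) :
  B_op c (mono p) = \sum_(i < p.+1) gbinom c (p - i) *: 'X^i :> {poly K}.
Proof.
rewrite xopX // => q qn; apply: (leq_trans (size_sum _ _ _)).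
apply/bigmax_leqP => i _; rewrite (leq_trans (size_scale_leq _ _)) //.
by rewrite size_polyXn (leq_trans (ltn_ord i)).
Qed.

Lemma U_op_inj : lker U_op == 0%VS.
Proof.
apply/lker0P => f g /eqP; rewrite -subr_eq0 -raddfB /= => /eqP Uf0.
apply/eqP; rewrite -subr_eq0; move: (f - g) Uf0 => {g}h Uf0.
have : U_op h = 0 :> {poly K} by rewrite Uf0.
rewrite xopE; last first.
  move=> q qn; rewrite (leq_trans (size_scale_leq _ _)) //.
  by rewrite size_XM ?size_euler // size_1X.
under eq_bigr do rewrite scalerA mulrC -scalerA.
rewrite -scaler_sumr => /eqP.
rewrite scaler_eq0 invr_eq0 pnatr_eq0 (gtn_eqF (fact_gt0 n)) /= => /eqP h0.
pose S : {poly K} := \poly_(m < n.+1) h.[m%:R].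
have XS : 'X^(n.+1) %| (1 - 'X) ^+ n.+1 * S.
  have -> : (1 - 'X) ^+ n.+1 * S = \sum_(p < n.+1) h`_p *: ((1 - 'X) ^+ (n - p)
     * ((1 - 'X) ^+ p.+1 * \poly_(m < n.+1) m%:R ^+ p - euler p)).
    under [RHS]eq_bigr do rewrite mulrBr scalerBr.
    rewrite sumrB h0 subr0.
    have -> : S = \sum_(p < n.+1) h`_p *: \poly_(m < n.+1) m%:R ^+ p.
      apply/polyP => m; rewrite coef_sum coef_poly.
      rewrite (horner_coef_wide _ (size_npoly h)).
      case: ifP => mn; last first.
        by rewrite big1 // => p _; rewrite coefZ coef_poly mn mulr0.
      by apply: eq_bigr => p _; rewrite coefZ coef_poly mn.
    rewrite mulr_sumr; apply: eq_bigr => p _.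
    by rewrite -scalerAr mulrA -exprD addnS subnK // -ltnS.
  apply: (big_ind (fun q => 'X^(n.+1) %| q)) => [|q r|p _].
  - exact: dvdp0.
  - exact: dvdp_add.
  by rewrite -mul_polyC !dvdp_mull // eulerP.
have S0 : S = 0.
  apply: contraTeq XS => S0; rewrite Gauss_dvdpr.
    apply/negP => /(dvdp_leq S0); rewrite size_polyXn ltnNge.
    by rewrite size_poly.
  rewrite coprimep_expl // coprimep_expr // coprimep_sym coprimepX.
  by rewrite rootE !hornerE subr0 oner_eq0.
apply/eqP/val_inj/eqP => /=; apply: contraT => hn0.
have := max_poly_roots (rs := [seq m%:R | m <- iota 0 n.+1]) hn0.
rewrite size_map size_iota => H; suff : (n.+1 < n.+1)%N by rewrite ltnn.
rewrite -[X in (_ < X)%N]/(n.+1) (leq_trans _ (size_npoly h)) //; apply: H.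
  apply/allP => x /mapP[m]; rewrite mem_iota add0n => /andP[_ mn] ->.
  by have := congr1 (fun q : {poly K} => q`_m) S0; rewrite coef_poly mn coef0 rootE => ->.
rewrite map_inj_in_uniq ?iota_uniq // => a b _ _ /eqP.
by rewrite eqr_nat => /eqP.
Qed.

Lemma V_op_inj : lker V_op == 0%VS.
Proof.
pose W : 'End({poly_n.+1 K}) := xop (fun p => (1 - 'X) ^+ (n - p) * 'X^p).
suff WV : (W \o V_op = \1)%VF.
  apply/lker0P => f g /(congr1 W).
  by rewrite -!comp_lfunE WV !id_lfunE.
have WE (h : {poly_n.+1 K}) :
    W h = \sum_(p < n.+1) h`_p *: ((1 - 'X) ^+ (n - p) * 'X^p) :> {poly K}.
  by rewrite xopE // => q qn; rewrite size_XM ?size_polyXn ?size_1X.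
have X1 (p : 'I_n.+1) : W (V_op (mono p)) = (mono p).
  apply/val_inj; rewrite /= WE V_opX npolyXE.
  have pn : (p <= n)%N by rewrite -ltnS.
  have E : 'X^p = \sum_(i < (n - p).+1)
      'X^p * ((1 - 'X) ^+ (n - p - i) * 'X^i *+ 'C(n - p, i)) :> {poly K}.
    by rewrite -mulr_sumr -exprDn subrK expr1n mulr1.
  rewrite [RHS]E.
  rewrite -(big_mkord xpredT (fun q => ((1 + 'X) ^+ (n - p) * 'X^p)`_q *:
     ((1 - 'X) ^+ (n - q) * 'X^q : {poly K}))).
  rewrite (big_cat_nat (n := p)) ?leqW //= big_nat_cond big1 ?add0r; last first.
    by move=> i /andP[/andP[_ ip] _]; rewrite coefMXn ip scale0r.
  rewrite -{1}[p : nat]add0n big_addn subSn // big_mkord.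
  apply: eq_bigr => i _; rewrite coefMXn ltnNge leq_addl /= addnK.
  rewrite exprDn coef_sum (bigD1 i) //= big1 ?addr0; last first.
    move=> j; rewrite -val_eqE /= => ji; rewrite expr1n mul1r coefMn coefXn.
    by rewrite eq_sym (negPf ji) mul0rn.
  rewrite expr1n mul1r coefMn coefXn eqxx scaler_nat mulrnAr; congr (_ *+ _).
  by rewrite mulrCA; congr (_ * _); rewrite ?[(i + p)%N]addnC ?exprD -?subnDA.
apply/lfunP => f; rewrite comp_lfunE id_lfunE.
have -> : f = \sum_(p < n.+1) f`_p *: (mono p).
  apply/val_inj; rewrite /= {1}(npolyX_gen (size_npoly f)).
  by rewrite (raddf_sum (@polyn K n.+1)).
by rewrite !linear_sum; apply: eq_bigr => p _; rewrite !linearZ /= X1.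
Qed.

(* [^-1] on 'End is a pseudo-inverse in general; by [U_op_inj] and [V_op_inj]
   it is the two-sided inverse for U_op and V_op. *)
Definition G_op (beta : K) : 'End({poly_n.+1 K}) :=
  (U_op \o E_op (n%:R * beta) \o U_op^-1)%VF.

End FixedDegree.
End Operators.

(* Main.v *)
Require Import Defs.
From mathcomp Require Import all_boot all_order all_algebra.
From mathcomp Require Import ring complex reals.

(* [V_n U_n] sends the Newton polynomial [binom(x, p)] to [x^p / n!]: modulo
   [x^(n+1)], [n! U_n f] is [(1-x)^(n+1) * sum_m f(m) x^m], and
   [sum_m binom(m, p) x^m = x^p / (1-x)^(p+1)]. In the Newton basis the shift
   [E^c] acts by Vandermonde's convolution
   [binom(x+c, p) = sum_i binom(c, p-i) binom(x, i)], which is how [B_c] acts on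
   the powers of [x]. *)

Set Implicit Arguments.
Unset Strict Implicit.
Unset Printing Implicit Defensive.

Import Order.TTheory GRing.Theory Num.Theory.
Local Open Scope ring_scope.

Section NewtonBasis.
Variable K : numFieldType.

Definition newton (p : nat) : {poly K} :=
  p`!%:R^-1 *: \prod_(i < p) ('X - i%:R%:P).

Lemma size_newton p : (size (newton p) <= p.+1)%N.
Proof.
rewrite (leq_trans (size_scale_leq _ _)) //.
rewrite -(big_mkord xpredT (fun i => 'X - i%:R%:P)).
by rewrite size_prod_XsubC size_iota subn0.
Qed.

Lemma newton0 : newton 0 = 1.
Proof. by rewrite /newton big_ord0 fact0 invr1 scale1r. Qed.

(** Stated without division, like [gbinomS]: the induction in [newton_shift] multiplies by [p + 1]
    and applies both recurrences. *)
Lemma newtonS p : p.+1%:R *: newton p.+1 = ('X - p%:R%:P) * newton p.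
Proof.
rewrite /newton big_ord_recr /= scalerA factS natrM invfM mulrA.
by rewrite mulfV ?pnatr_eq0 // mul1r -scalerAr mulrC.
Qed.

Lemma gbinom0 (c : K) : gbinom c 0 = 1.
Proof. by rewrite /gbinom big_ord0 fact0 divr1. Qed.

Lemma gbinomS (c : K) k : k.+1%:R * gbinom c k.+1 = (c - k%:R) * gbinom c k.
Proof.
rewrite /gbinom big_ord_recr /= factS natrM invfM.
have k0 : k.+1%:R != 0 :> K by rewrite pnatr_eq0.
have f0 : k`!%:R != 0 :> K by rewrite pnatr_eq0 -lt0n fact_gt0.
by field; rewrite f0 addrC natr1 k0.
Qed.

Lemma horner_newton p m : (newton p).[m%:R] = 'C(m, p)%:R.
Proof.
elim: p => [|p IH]; first by rewrite newton0 hornerC bin0.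
have p0 : p.+1%:R != 0 :> K by rewrite pnatr_eq0.
apply: (mulfI p0); rewrite -hornerZ newtonS hornerM IH !hornerE -natrM.
(* For [m < p] the natural-number difference [m - p] is truncated to 0, which is harmless because
   ['C(m, p) = 0]. *)
rewrite mul_bin_left natrM; case: (leqP p m) => pm; first by rewrite natrB.
by rewrite bin_small // !mulr0.
Qed.

(* Both sides satisfy [(p+1) T_(p+1) = (x + c - p) T_p]: write [p + 1] as
   [(p + 1 - i) + i] in the i-th term of the sum. *)
Lemma newton_shift (c : K) p :
  newton p \Po ('X + c%:P) = \sum_(i < p.+1) gbinom c (p - i) *: newton i.
Proof.
elim: p => [|p IH].
  by rewrite big_ord1 newton0 gbinom0 scale1r comp_polyC.
have p0 : p.+1%:R != 0 :> K by rewrite pnatr_eq0.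
apply: (scalerI p0); rewrite -comp_polyZ newtonS comp_polyM IH.
rewrite comp_polyB comp_polyX comp_polyC.
have -> : p.+1%:R *: (\sum_(i < p.+2) gbinom c (p.+1 - i) *: newton i) =
    \sum_(i < p.+2) ((p.+1 - i)%:R * gbinom c (p.+1 - i)) *: newton i +
    \sum_(i < p.+2) gbinom c (p.+1 - i) *: (i%:R *: newton i).
  rewrite scaler_sumr -big_split; apply: eq_bigr => i _ /=.
  rewrite (scalerA p.+1%:R) (scalerA (gbinom _ _)) -scalerDl; congr (_ *: _).
  by rewrite [gbinom _ _ * _]mulrC -mulrDl -natrD subnK // -ltnS.
(* The last term of the first sum and the initial term of the second vanish. After reindexing, both
   run over [i <= p], and their factors [c - (p - i)] and [x - i] add up to [x + c - p]. *)
rewrite [X in _ = X + _]big_ord_recr /= subnn mul0r scale0r addr0.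
rewrite [X in _ = _ + X]big_ord_recl /= scale0r scaler0 add0r.
rewrite mulr_sumr -big_split; apply: eq_bigr => i _ /=.
have ip : (i <= p)%N by rewrite -ltnS.
rewrite subSn // gbinomS newtonS /bump /= subSS natrB //.
rewrite -!mul_polyC !rmorphM !rmorphB /=.
by ring.
Qed.

(** The generating function of ['C(m, p)] with denominators cleared and the series cut at [x^N]. By
    Pascal's rule, [1 - x] times the series for [p + 1] is [x] times the series for [p], modulo
    [x^N]. *)
Lemma newton_genfun p N : 'X^N %|
  (1 - 'X) ^+ p.+1 * \poly_(m < N) (newton p).[m%:R] - 'X^p.
Proof.
have dvdXn (q : {poly K}) : (forall i, (i < N)%N -> q`_i = 0) -> 'X^N %| q.
  move=> q0; apply/dvdpP; exists (drop_poly N q).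
  rewrite -[LHS](poly_take_drop N) (_ : take_poly N q = 0) ?add0r //.
  apply/polyP => i; rewrite coef_take_poly coef0.
  by case: ifP => // /q0.
elim: p => [|p IH].
  apply: dvdXn => i iN; rewrite expr1 mulrBl mul1r !coefB mulrC coefMX.
  rewrite !coef_poly iN horner_newton bin0 expr0 coef1.
  case: i iN => [|i] iN /=; first by rewrite subr0 subrr.
  by rewrite (ltnW iN) horner_newton bin0 subrr subr0.
set S := \poly_(m < N) _; pose T : {poly K} := \poly_(m < N) (newton p).[m%:R].
have ST : 'X^N %| (1 - 'X) * S - 'X * T.
  apply: dvdXn => i iN; rewrite mulrBl mul1r !coefB ![ 'X * _]mulrC !coefMX.
  rewrite !coef_poly iN !horner_newton.
  case: i iN => [|i] iN /=; first by rewrite bin0n !subr0.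
  by rewrite (ltnW iN) binS natrD -addrA -opprD subrr.
have := dvdp_add (dvdp_mull ((1 - 'X) ^+ p.+1) ST) (dvdp_mull 'X IH).
rewrite -/T; congr (_ %| _); rewrite !exprS; ring.
Qed.

Section FixedDegree.
Variable n : nat.

Local Notation mono p := (tnth (npolyX K n.+1) p).

Lemma size_subX_expM (q : {poly K}) p : (p <= n)%N -> (size q <= p.+1)%N ->
  (size ((1 - 'X) ^+ (n - p) * q)%R <= n.+1)%N.
Proof.
move=> pn sq; rewrite (leq_trans (size_polyMleq _ _)) //.
rewrite -subn1 leq_subLR add1n.
have -> : n.+2 = ((n - p).+1 + p.+1)%N by rewrite addSn addnS subnK.
rewrite leq_add // (leq_trans (size_poly_exp_leq _ _)) //.
by rewrite -opprB size_polyN size_XsubC mul1n.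
Qed.

(** By linearity [eulerP] gives the congruence satisfied by [n! U_n f], and a polynomial of degree
    at most [n] is determined by its residue modulo [x^(n+1)]. *)
Lemma U_op_genfun (f : {poly_n.+1 K}) (q : {poly K}) :
    (size q <= n.+1)%N ->
    'X^(n.+1) %| (1 - 'X) ^+ n.+1 * \poly_(m < n.+1) f.[m%:R] - q ->
  U_op K n f = n`!%:R^-1 *: q :> {poly K}.
Proof.
move=> sq qP; rewrite xopE; last first.
  move=> p pn; rewrite (leq_trans (size_scale_leq _ _)) //.
  exact: size_subX_expM (size_euler _ _).
under eq_bigr do rewrite scalerA mulrC -scalerA.
rewrite -scaler_sumr; congr (_ *: _); set h := \sum_(p < _) _.
have sh : (size h <= n.+1)%N.
  apply: (leq_trans (size_sum _ _ _)); apply/bigmax_leqP => p _.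
  rewrite (leq_trans (size_scale_leq _ _)) //.
  by rewrite size_subX_expM ?size_euler // -ltnS.
have hP : 'X^(n.+1) %| (1 - 'X) ^+ n.+1 * \poly_(m < n.+1) f.[m%:R] - h.
  have -> : \poly_(m < n.+1) f.[m%:R] =
      \sum_(p < n.+1) f`_p *: \poly_(m < n.+1) m%:R ^+ p.
    apply/polyP => m; rewrite coef_sum coef_poly.
    rewrite (horner_coef_wide _ (size_npoly f)).
    case: ifP => mn; last first.
      by rewrite big1 // => p _; rewrite coefZ coef_poly mn mulr0.
    by apply: eq_bigr => p _; rewrite coefZ coef_poly mn.
  rewrite mulr_sumr -sumrB.
  apply: (big_ind (fun q => 'X^(n.+1) %| q)) => [|r s|p _].
  - exact: dvdp0.
  - exact: dvdp_add.
  have pn : (p <= n)%N by rewrite -ltnS.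
  (* The factor [(1-x)^(n-p)] lifts the exponent [p + 1] of [eulerP] to the common exponent
     [n + 1]. *)
  rewrite -scalerAr -scalerBr -[X in (1 - _) ^+ X.+1](subnK pn) -addnS exprD.
  by rewrite -mulrA -mulrBr -mul_polyC !dvdp_mull // eulerP.
apply/eqP; rewrite -subr_eq0; apply: contraT => hq0.
have : 'X^(n.+1) %| h - q.
  by have := dvdp_sub qP hP; rewrite opprB addrC addrA subrK.
move/(dvdp_leq hq0); rewrite size_polyXn leqNgt ltnS.
by rewrite (leq_trans (size_polyD _ _)) // size_polyN geq_max sh.
Qed.

(** Expanding [(1-x)^(n-p)] and applying [V_n] termwise gives the binomial expansion of
    [((1+x) - x)^(n-p) x^p]. *)
Lemma V_op_bernstein p (h : {poly_n.+1 K}) : (p <= n)%N ->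
  h = (1 - 'X) ^+ (n - p) * 'X^p :> {poly K} -> V_op K n h = 'X^p :> {poly K}.
Proof.
move=> pn hE.
have -> : h = \sum_(i < (n - p).+1)
    ((-1) ^+ i * 'C(n - p, i)%:R) *: mono (inord (p + i)).
  apply/val_inj; rewrite /= hE (raddf_sum (@polyn K n.+1)) exprDn mulr_suml.
  apply: eq_bigr => i _ /=.
  rewrite npolyXE inordK; last by rewrite ltnS -leq_subRL // -ltnS.
  rewrite expr1n mul1r (exprNn 'X) -scalerA scaler_nat -mul_polyC rmorphXn.
  rewrite rmorphN1.
  by rewrite mulrnAl mulrnAr addnC exprD mulrA.
rewrite linear_sum (raddf_sum (@polyn K n.+1)) /=.
transitivity (\sum_(i < (n - p).+1)
    (1 + 'X) ^+ (n - p - i) * (- 'X) ^+ i *+ 'C(n - p, i) * 'X^p : {poly K}).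
  apply: eq_bigr => i _; rewrite linearZ /= V_opX.
  rewrite inordK; last by rewrite ltnS -leq_subRL // -ltnS.
  rewrite subnDA (exprNn 'X) -scalerA scaler_nat -mul_polyC rmorphXn.
  rewrite rmorphN1.
  rewrite mulrnAl mulrnAr addnC exprD /=; congr (_ *+ _).
  by rewrite mulrCA -!mulrA.
by rewrite -mulr_suml -exprDn addrK expr1n mul1r.
Qed.

Lemma newtonK p : (p <= n)%N -> npolyp n.+1 (newton p) = newton p :> {poly K}.
Proof. by move=> pn; rewrite /= npolypK // (leq_trans (size_newton _)). Qed.

(** Multiplying [newton_genfun] by [(1-x)^(n-p)] identifies [n! U_n binom(x, p)] as
    [(1-x)^(n-p) x^p], to which [V_op_bernstein] applies. *)
Lemma VU_newton p : (p <= n)%N ->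
  V_op K n (U_op K n (npolyp n.+1 (newton p))) = n`!%:R^-1 *: 'X^p :> {poly K}.
Proof.
move=> pn; pose h := npolyp n.+1 ((1 - 'X) ^+ (n - p) * 'X^p : {poly K}).
have hE : h = (1 - 'X) ^+ (n - p) * 'X^p :> {poly K}.
  by rewrite /= npolypK // size_subX_expM ?size_polyXn.
have -> : U_op K n (npolyp n.+1 (newton p)) = n`!%:R^-1 *: h.
  apply/val_inj; rewrite /= hE; apply: U_op_genfun.
    by rewrite size_subX_expM ?size_polyXn.
  rewrite newtonK // -[X in (1 - _) ^+ X.+1](subnK pn) -addnS exprD.
  by rewrite -mulrA -mulrBr dvdp_mull // newton_genfun.
by rewrite linearZ /= (V_op_bernstein pn hE).
Qed.

Lemma VU_op_inj : injective (V_op K n \o U_op K n)%VF.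
Proof.
move=> f g; rewrite !comp_lfunE => /(lker0P (V_op_inj K n)).
exact: (lker0P (U_op_inj K n)).
Qed.

(** The coefficients are read off from [V_n U_n f] in the monomial basis, where [n!] cancels the
    scalar of [VU_newton]; injectivity of [V_n U_n] carries the expansion back to [f]. *)
Lemma newton_gen (f : {poly_n.+1 K}) :
  exists a : nat -> K, f = \sum_(p < n.+1) a p *: npolyp n.+1 (newton p).
Proof.
pose g := V_op K n (U_op K n f).
exists (fun p => n`!%:R * g`_p); apply: VU_op_inj.
rewrite linear_sum comp_lfunE -/g; apply/val_inj.
rewrite /= (raddf_sum (@polyn K n.+1)) {1}(npolyX_gen (size_npoly g)).
rewrite (raddf_sum (@polyn K n.+1)) /=.
apply: eq_bigr => p _; rewrite linearZ /= comp_lfunE.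
rewrite VU_newton; last by rewrite -ltnS.
rewrite npolyXE scalerA mulrAC mulfV ?mul1r //.
by rewrite pnatr_eq0 -lt0n fact_gt0.
Qed.

(** The shift of [binom(x, p)] and the image of [x^p] under [B_c] have the same coefficients, and
    the scalar [1/n!] in [VU_newton] does not depend on [p]. *)
Lemma VU_E_newton c p : (p <= n)%N ->
  V_op K n (U_op K n (E_op n c (npolyp n.+1 (newton p)))) =
  B_op n c (V_op K n (U_op K n (npolyp n.+1 (newton p)))).
Proof.
move=> pn.
have -> : E_op n c (npolyp n.+1 (newton p)) =
    \sum_(i < p.+1) gbinom c (p - i) *: npolyp n.+1 (newton i).
  apply/val_inj; rewrite /= E_opE newtonK // newton_shift.
  rewrite (raddf_sum (@polyn K n.+1)); apply: eq_bigr => i _ /=.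
  by rewrite npolypK // (leq_trans (size_newton _)) // (leq_trans (ltn_ord i)).
have -> : V_op K n (U_op K n (npolyp n.+1 (newton p))) =
    n`!%:R^-1 *: mono (inord p).
  by apply/val_inj; rewrite /= VU_newton // npolyXE inordK.
rewrite !linear_sum linearZ; apply/val_inj; rewrite /= B_opX inordK //.
rewrite (raddf_sum (@polyn K n.+1)) scaler_sumr; apply: eq_bigr => i _.
rewrite !linearZ /= VU_newton; last by rewrite (leq_trans _ pn) // -ltnS.
by rewrite !scalerA mulrC.
Qed.

Lemma G_op_conj (beta : K) :
  G_op n beta = ((V_op K n)^-1 \o B_op n (n%:R * beta) \o V_op K n)%VF.
Proof.
(* By linearity, this intertwining relation need only hold on the Newton polynomials. *)
have VUE : (V_op K n \o U_op K n \o E_op n (n%:R * beta) =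
    B_op n (n%:R * beta) \o V_op K n \o U_op K n)%VF.
  apply/lfunP => f; have [a ->] := newton_gen f.
  rewrite !comp_lfunE !linear_sum; apply: eq_bigr => p _.
  by rewrite !linearZ /= VU_E_newton // -ltnS.
(* As [V_n] is injective, it may be applied to both sides; writing [f] as [U_n (U_n^-1 f)] then
   leaves [VUE] at [U_n^-1 f]. *)
apply/lfunP => f; apply: (lker0P (V_op_inj K n)).
rewrite /G_op -{2}[f](lker0_lfunVK (U_op_inj K n)).
rewrite !comp_lfunE (lker0_lfunVK (V_op_inj K n)).
by have /lfunP/(_ ((U_op K n)^-1%VF f)) := VUE; rewrite !comp_lfunE.
Qed.

End FixedDegree.
End NewtonBasis.

Theorem theorem16 (R : realType) (n : nat) (beta : R[i]%C) :
  G_op n beta = ((V_op R[i]%C n)^-1 \o B_op n (n%:R * beta) \o V_op R[i]%C n)%VF.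
Proof. exact: G_op_conj. Qed.
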